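(* Let $r\geq 1$ and let $a_1,\dots,a_r$ be positive integers, and let $G=(\mathbb Z/a_1\mathbb Z)\times\dots\times(\mathbb Z/a_r\mathbb Z)$ (an $r$-dimensional grid with periodic addition). Let $f:G\to\mathbb Q$ be a rational-valued function. (i) If $|G|$ is odd, then $f$ is determined up to translation by its autocorrelations up to order $2r+2$: for every rational-valued $g:G\to\mathbb Q$ with $M_n(g;x_1,\dots,x_{n-1})=M_n(f;x_1,\dots,x_{n-1})$ for all $1\le n\le 2r+2$ and all $x_1,\dots,x_{n-1}\in G$, there exists $y\in G$ with $g(x)=f(x+y)$ for all $x\in G$. (ii) If $|G|$ is even, the same conclusion holds with $2r+2$ replaced by $3r+3$.
   Context: Elements of $G$ are $r$-tuples $x=(x[1],\dots,x[r])$ with $x[k]\in\mathbb Z/a_k\mathbb Z$, and addition is componentwise modulo $a_k$ in the $k$-th coordinate. For a function $f:G\to\mathbb C$ and $n\ge 1$, the $n$-th order autocorrelation is $M_n(f;x_1,\dots,x_{n-1})=\sum_{y\in G}f(y)f(y+x_1)\cdots f(y+x_{n-1})$ for $x_1,\dots,x_{n-1}\in G$ (so $M_1(f)=\sum_{y\in G}f(y)$). *)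

(* Defs.v *)
From HB Require Import structures.
From mathcomp Require Import all_boot all_order all_algebra.
Set Implicit Arguments. Unset Strict Implicit. Unset Printing Implicit Defensive.
Import Order.TTheory GRing.Theory Num.Theory.
Local Open Scope ring_scope.

(* The grid G = Z/a_1 x ... x Z/a_r : elements are dependent finite functions
   k |-> x[k] in 'I_(a k), i.e. residues 0 <= x[k] < a k. *)
Definition grid (r : nat) (a : 'I_r -> nat) : finType :=
  {dffun forall k : 'I_r, 'I_(a k)}.

Lemma ord_pos (n : nat) (i : 'I_n) : (0 < n)%N.
Proof. by apply: leq_ltn_trans (ltn_ord i). Qed.

Definition ord_addmod (n : nat) (i j : 'I_n) : 'I_n :=
  Ordinal (ltn_pmod (i + j)%N (ord_pos i)).

Definition grid_add (r : nat) (a : 'I_r -> nat) (x y : grid a) : grid a :=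
  [ffun k => ord_addmod (x k) (y k)].

(* M_n(f; x_1, ..., x_{n-1}) = sum_y f(y) f(y+x_1) ... f(y+x_{n-1}),
   where xs = [:: x_1; ...; x_{n-1}] (so n = size xs + 1). *)
Definition autocorr (r : nat) (a : 'I_r -> nat) (f : grid a -> rat)
  (xs : seq (grid a)) : rat :=
  \sum_(y : grid a) f y * \prod_(x <- xs) f (grid_add y x).

(* Main.v *)
(* Over the complex numbers the autocorrelations of order n are the products
   F(k_1)...F(k_n) of Fourier coefficients over the relations k_1 + ... + k_n = 0,
   so on the common support S the quotient h = G/F satisfies h(k_1)...h(k_n) = 1
   for every relation of length at most q(r+1), with q = 2 or 3. It suffices
   to extend this to relations of every length: then all autocorrelations of f
   and g agree, and the polynomial P(u) = prod_w sum_x (u(x) - f(x+w))^2, which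
   vanishes exactly on the orbit of f, has sum_y g(y)^2 P(T_y g) =
   sum_y f(y)^2 P(T_y f) = 0, T_y being translation by y.
   As f is rational, Galois conjugation shows that S is stable under
   multiplication by units modulo |G|. Every integer is a sum of at most q units
   (q = 2 if |G| is odd, q = 3 if not), and short relations give
   h(us)h(vs)... = h(s)^(u+v+...); hence a relation between arbitrary multiples of
   r+1 elements of S costs only length q(r+1). Finally, localised at a prime p,
   any subset of Z^r is spanned by r of its members, which breaks every
   relation, up to a factor prime to p, into such relations. *)
Require Import Defs.
From HB Require Import structures.
From mathcomp Require Import all_boot all_order all_algebra all_field.
From mathcomp Require Import ring zify.
Set Implicit Arguments. Unset Strict Implicit. Unset Printing Implicit Defensive.
Import Order.TTheory GRing.Theory Num.Theory.
Local Open Scope ring_scope.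

(** * Units modulo [N] by Chinese remaindering *)

Lemma coprime_absz_primes (N : nat) (t : int) : (0 < N)%N ->
  (forall p : nat, prime p -> (p %| N)%N -> ~~ (p %| t)%Z) -> coprime `|t| N.
Proof.
move=> N0 H; apply/negPn/negP => nc.
have g1 : (1 < gcdn `|t| N)%N.
  by rewrite ltn_neqAle eq_sym nc gcdn_gt0 N0 orbT.
have := H _ (pdiv_prime g1) (dvdn_trans (pdiv_dvd _) (dvdn_gcdr _ _)).
by rewrite dvdzE (dvdn_trans (pdiv_dvd _) (dvdn_gcdl _ _)).
Qed.

(** The third hypothesis makes [P p] depend only on the class modulo [p], so local solutions glue
    along the distinct primes. *)
Lemma crt_primes (ps : seq nat) (P : nat -> pred int) :
  uniq ps -> {in ps, forall p, prime p} ->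
  (forall p v w, P p v -> P p (v + p%:Z * w)) ->
  {in ps, forall p, exists v, P p v} ->
  exists v, {in ps, forall p, P p v}.
Proof.
move=> + + per; elim: ps => [|p ps IH] /=; first by exists 0.
move=> /andP[pps ups] pr loc.
have [|q qps|v vP] := IH ups; first by move=> q qps; rewrite pr // inE qps orbT.
  by apply: loc; rewrite inE qps orbT.
have [w wP] := loc p (mem_head _ _).
have pp : prime p by rewrite pr // mem_head.
have shift (q : nat) (x y : int) : (x = y %[mod q])%Z -> P q y -> P q x.
  move=> /eqP; rewrite eqz_mod_dvd => /dvdzP[k xy] Py.
  have -> : x = y + q%:Z * k by rewrite mulrC -xy addrC subrK.
  exact: per.
have co : coprimez p (\prod_(q <- ps) q)%N.
  rewrite coprimezE /= big_seq.
  elim/big_ind: _ => [|a b pa pb|q qps]; rewrite ?coprimen1 ?coprimeMr ?pa //.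
  have pq : prime q by rewrite pr // inE qps orbT.
  rewrite prime_coprime // dvdn_prime2 //.
  by apply: contraNneq pps => ->.
exists (zchinese p (\prod_(q <- ps) q)%N w v) => q; rewrite inE => /orP[/eqP ->|qps].
  by apply: shift wP; apply: zchinese_modl.
apply: shift (vP _ qps).
have : (q %| (\prod_(q <- ps) q)%N%:Z)%Z.
  by rewrite dvdzE /= (big_rem q) //= dvdn_mulr.
move=> /dvdzP[k Nk].
have /eqP := zchinese_modr co w v; rewrite eqz_mod_dvd => h.
apply/eqP; rewrite eqz_mod_dvd; apply: dvdz_trans h.
by rewrite Nk dvdz_mull.
Qed.

Lemma crt_primes_dvd (N : nat) (P : nat -> pred int) : (0 < N)%N ->
  (forall p v w, P p v -> P p (v + p%:Z * w)) ->
  (forall p, prime p -> (p %| N)%N -> exists v, P p v) ->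
  exists v, forall p, prime p -> (p %| N)%N -> P p v.
Proof.
move=> N0 per loc; have [||v vP] := @crt_primes (primes N) P (primes_uniq N) _ per.
- by move=> p; rewrite mem_primes => /andP[].
- by move=> p; rewrite mem_primes => /and3P[pp _ pN]; apply: loc.
by exists v => p pp pN; apply: vP; rewrite mem_primes pp N0.
Qed.

Lemma dvdz_add_mod (p v w x : int) : (p %| x + (v + p * w))%Z = (p %| x + v)%Z.
Proof. by rewrite addrA rpredDr // dvdz_mulr. Qed.

(** Prime by prime, [v] must avoid the classes of 0 and [x]. One of 1 and -1 does so at odd primes;
    at 2 the two forbidden classes coincide, [x] being even. *)
Lemma unit_sum2 (N : nat) (x : int) : (0 < N)%N -> odd N || (2 %| x)%Z ->
  exists u v : int, [/\ coprime `|u| N, coprime `|v| N & u + v = x].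
Proof.
move=> N0 ox.
have [|p pp pN|v vP] :=
  @crt_primes_dvd N (fun p v => ~~ (p %| 0 + v)%Z && ~~ (p %| - x + v)%Z) N0.
- by move=> p v w; rewrite !dvdz_add_mod.
- have p1 : ~~ (p %| 1)%Z by rewrite dvdzE dvdn1 /=; apply: contraTneq pp => ->.
  case: (boolP (p %| - x + 1)%Z) => h; last by exists 1; rewrite add0r p1 h.
  exists (- 1); rewrite add0r rpredN p1 /=; apply/negP => h'.
  have p2 : (p %| 2%:Z)%Z.
    have -> : 2%:Z = (- x + 1) - (- x - 1) by lia.
    exact: (rpredB h h').
  move: p2; rewrite dvdzE /= dvdn_prime2 // => /eqP p2; subst p.
  by move: pN ox; rewrite dvdn2 => /negPf -> /=; lia.
exists v, (x - v); split; last by ring.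
  by apply: coprime_absz_primes => // p pp pN; have /andP[] := vP p pp pN; rewrite add0r.
apply: coprime_absz_primes => // p pp pN; have /andP[_] := vP p pp pN.
by rewrite (_ : - x + v = - (x - v)) ?rpredN //; ring.
Qed.

(* The third constraint is what one unit step x -> x + t needs; modulo 3 it is
   satisfiable only when x and t are incongruent. *)
Lemma unit_sum2_shift (N : nat) (x t : int) : odd N -> coprime `|t| N ->
  ~~ (3 %| x - t)%Z ->
  exists v : int, [/\ coprime `|v| N, coprime `|x - v| N & coprime `|v + t| N].
Proof.
move=> oN ct xt; have N0 : (0 < N)%N by case: N oN {ct}.
have [|p pp pN|v vP] :=
  @crt_primes_dvd N (fun p v => [&& ~~ (p %| 0 + v)%Z, ~~ (p %| - x + v)%Z
    & ~~ (p %| t + v)%Z]) N0.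
- by move=> p v w; rewrite !dvdz_add_mod.
- have pt : ~~ (p %| t)%Z.
    rewrite dvdzE /= -prime_coprime // coprime_sym.
    by apply: coprime_dvdr pN _.
  have [p3|p3] := eqVneq p 3%N.
    (* At 3 the choice [v = t] asks that [t], [x - t] and [2t] be nonzero, which holds. *)
    subst p; exists t; rewrite add0r pt /= (_ : - x + t = - (x - t)) ?rpredN; last by ring.
    by rewrite xt /=; lia.
  have p4 : (3 < p)%N.
    have := prime_gt1 pp; case: p pp pN pt p3 => [|[|[|[|p]]]] // _ pN _ _ _.
    by move: pN; rewrite dvdn2 oN.
  (* At most three classes are forbidden, so a prime above 3 leaves one free. *)
  pose bad := [:: `|(0 %% p)%Z|%N; `|(x %% p)%Z|%N; `|(- t %% p)%Z|%N].
  have [v vp vbad] : exists2 v, (v < p)%N & v \notin bad.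
    case: (boolP (all (fun v => v \in bad) (iota 0 p))) => [/allP sub|].
      have := uniq_leq_size (iota_uniq 0 p) sub; rewrite size_iota /= => h.
      by rewrite ltnNge h in p4.
    case/allPn => v; rewrite mem_iota add0n /= => vp vb; by exists v.
  have pz : p%:Z != 0 by case: p p4 {pp pN pt p3 bad vp vbad}.
  have key (y : int) : (p %| - y + v%:Z)%Z -> v = `|(y %% p)%Z|%N.
    rewrite addrC -eqz_mod_dvd => /eqP; rewrite modz_small; last by rewrite /= ltz_nat vp.
    by move=> <-.
  exists v%:Z; apply/and3P; split; apply: contra vbad; rewrite !inE.
  - by rewrite -[X in X + _]oppr0 => /key <-; rewrite eqxx.
  - by move=> /key <-; rewrite eqxx orbT.
  - by rewrite -[X in X + _]opprK => /key <-; rewrite eqxx !orbT.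
exists v; split; apply: coprime_absz_primes => // p pp pN; have /and3P[] := vP p pp pN.
- by rewrite add0r.
- by rewrite (_ : - x + v = - (x - v)) ?rpredN //; ring.
- by rewrite [t + v]addrC.
Qed.

(** * Linear algebra over the integers localised at a prime *)

(** A nonzero entry of least [p]-adic valuation divides all others up to its [p]-free part, which
    serves as [m]. *)
Lemma min_valuation_pivot (I : finType) (i0 : I) (p : nat) (x : I -> int) :
  prime p -> exists i, exists2 m : int, ~~ (p %| m)%Z &
    forall j, exists c : int, m * x j = c * x i.
Proof.
move=> pp; case: (pickP (fun i => x i != 0)) => [i1 xi1|x0]; last first.
  exists i0, 1; first by rewrite dvdzE dvdn1 /=; apply: contraTneq pp => ->.
  by move=> j; exists 0; have /eqP := negbFE (x0 j) => ->; rewrite mul1r mul0r.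
case: (@arg_minnP I i1 (fun i => x i != 0) (fun i => logn p `|x i|) xi1) => i xi imin.
exists i.
have xi0 : (0 < `|x i|)%N by rewrite absz_gt0.
have [[|q] pq e] := pfactor_coprime pp xi0.
  by rewrite mul0n in e; rewrite e in xi0.
exists (Posz q.+1); first by rewrite dvdzE /= -prime_coprime.
move=> j; have [->|xj] := eqVneq (x j) 0; first by exists 0; rewrite mulr0 mul0r.
have : (p ^ logn p `|x i| %| `|x j|)%N.
  by rewrite pfactor_dvdn ?absz_gt0 // imin.
rewrite -[X in (X %| _)%N]/(`|(p ^ logn p `|x i|)%N%:Z|%N) -dvdzE => /dvdzP[k kE].
have xE : x i = sgz (x i) * (Posz q.+1 * Posz (p ^ logn p `|x i|)).
  by rewrite -PoszM -e -intEsg.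
have ss : sgz (x i) * sgz (x i) = 1 by rewrite mulz_sg xi.
exists (sgz (x i) * k); rewrite kE; move: xE ss; set P := Posz (p ^ _).
by set s := sgz _ => -> ss; rewrite -[LHS]mul1r -ss; ring.
Qed.

(* A p-local version of Burnside's basis theorem. *)
Lemma local_basis (I : finType) (i0 : I) (p r d : nat) (s : I -> 'rV[int]_r) :
  prime p -> exists (b : 'I_d -> I) (m : int), ~~ (p %| m)%Z /\
    forall i, exists c : 'I_d -> int, forall l : 'I_r, (l < d)%N ->
      (s i *~ m - \sum_j s (b j) *~ c j) 0 l = 0.
Proof.
(* Gaussian elimination, one coordinate for each step of the induction on [d]. *)
move=> pp; elim: d s => [|d IH] s.
  exists (fun _ => i0), 1; split; first by rewrite dvdzE dvdn1 /=; apply: contraTneq pp => ->.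
  by move=> i; exists (fun _ => 0).
(* Past the last coordinate nothing is left to clear, and the extra member gets coefficient 0. *)
case: (ltnP d r) => dr; last first.
  have [b [m [pm H]]] := IH s.
  exists (fun j => if unlift ord0 j is Some j' then b j' else i0), m; split=> // i.
  have [c cE] := H i.
  exists (fun j => if unlift ord0 j is Some j' then c j' else 0) => l _.
  rewrite big_ord_recl unlift_none mulr0z add0r.
  under eq_bigr => j _ do rewrite liftK.
  by apply: cE; apply: leq_trans (ltn_ord l) dr.
pose o := Ordinal dr.
have [i [m pm piv]] := @min_valuation_pivot I i0 p (fun i => s i 0 o) pp.
have [c cE] : exists c : I -> int, forall j, m * s j 0 o = c j * s i 0 o.
  by apply: (@fin_all_exists _ (fun _ => int) (fun j c => m * s j 0 o = c * s i 0 o)).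
have entry (v : 'rV[int]_r) (n : int) : (v *~ n) 0 o = n * v 0 o.
  by rewrite -scaler_int mxE intz.
(* Subtracting multiples of the pivot [s i] clears coordinate [o] of every member at once. *)
pose s' j := s j *~ m - s i *~ c j.
have s'0 j : s' j 0 o = 0.
  by rewrite !mxE -!scaler_int !mxE !intz cE subrr.
have [b [m2 [pm2 H]]] := IH s'.
exists (fun j => if unlift ord0 j is Some j' then b j' else i), (m * m2); split.
  by rewrite dvdzE abszM Euclid_dvdM // negb_or -!dvdzE pm.
move=> k; have [e eE] := H k.
(* The combination of the [s'] is expanded back in terms of [s], the pivot collecting all
   corrections. *)
exists (fun j => if unlift ord0 j is Some j' then m * e j'
  else c k * m2 - \sum_j' c (b j') * e j') => l ld.
have -> : s k *~ (m * m2) - \sum_j s (if unlift ord0 j is Some j' then b j' else i) *~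
     (if unlift ord0 j is Some j' then m * e j' else c k * m2 - \sum_j' c (b j') * e j')
   = s' k *~ m2 - \sum_j s' (b j) *~ e j.
  rewrite big_ord_recl unlift_none.
  under [X in _ - (_ + X)]eq_bigr => j _ do rewrite liftK.
  under [X in _ = _ - X]eq_bigr => j _ do rewrite mulrzBl -!mulrzA.
  rewrite sumrB mulrzBl -!mulrzA mulrzBr mulrz_sumr.
  by rewrite -[RHS]addrA; congr (_ + _); rewrite opprD !opprB [X in X - _ = _]addrC -addrA.
move: ld; rewrite ltnS leq_eqVlt => /orP[/eqP ld|]; last exact: eE.
have -> : l = o by apply: val_inj.
rewrite mxE entry s'0 mulr0 add0r mxE summxE big1 ?oppr0 // => j _.
by rewrite entry s'0 mulr0.
Qed.

(** * Powers of [h] through unit multiples *)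

(** In the application [T] holds of the frequencies whose character is trivial. Frequencies thus
    stay integer vectors instead of residues, as the local linear algebra requires. The support is
    encoded by [h s != 0]. *)
Definition relations_upto (V : zmodType) (K : fieldType) (T : V -> Prop)
    (h : V -> K) (n : nat) : Prop :=
  forall ss : seq V, (size ss <= n)%N -> all (fun s => h s != 0) ss ->
    T (\sum_(s <- ss) s) -> \prod_(s <- ss) h s = 1.

Definition unit_stable (V : zmodType) (K : fieldType) (N : nat) (h : V -> K) : Prop :=
  forall (s : V) (t : int), coprime `|t| N -> h s != 0 -> h (s *~ t) != 0.

Definition power_witness (V : zmodType) (K : fieldType) (N : nat) (h : V -> K)
    (q : nat) (s : V) (k : int) (us : seq int) : Prop :=
  [/\ all (fun u : int => coprime `|u| N) us, (size us <= q)%N, \sum_(u <- us) u = k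
    & \prod_(u <- us) h (s *~ u) = h s ^ k].

Lemma mulrz_sum_seq (V : zmodType) (s : V) (us : seq int) :
  \sum_(u <- us) s *~ u = s *~ (\sum_(u <- us) u).
Proof.
elim: us => [|u us IH]; first by rewrite !big_nil mulr0z.
by rewrite !big_cons IH mulrzDr.
Qed.

Lemma unit_opp (V : zmodType) (K : fieldType) (T : V -> Prop) (h : V -> K)
    (N n : nat) (s : V) (u : int) :
  T 0 -> (1 < n)%N -> relations_upto T h n -> unit_stable N h -> h s != 0 ->
  coprime `|u| N -> h (s *~ - u) = (h (s *~ u))^-1.
Proof.
move=> T0 n1 rel st hs cu; have hu := st s u cu hs.
have hnu : h (s *~ - u) != 0 by apply: st; rewrite // abszN.
apply: (mulfI hu); rewrite divff //.
have := rel [:: s *~ u; s *~ - u] n1; rewrite /= hu hnu !big_cons !big_nil.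
by rewrite mulr1 addr0 -mulrzDr subrr mulr0z; apply.
Qed.

(** Negating [ws] moves it to the other side: [h] is inverted by [unit_opp], and the resulting
    relation has length [size us + size ws]. *)
Lemma unit_relation (V : zmodType) (K : fieldType) (T : V -> Prop) (h : V -> K)
    (N n : nat) (s : V) (us ws : seq int) :
  T 0 -> (1 < n)%N -> relations_upto T h n -> unit_stable N h -> h s != 0 ->
  all (fun u : int => coprime `|u| N) us -> all (fun w : int => coprime `|w| N) ws ->
  \sum_(u <- us) u = \sum_(w <- ws) w -> (size us + size ws <= n)%N ->
  \prod_(u <- us) h (s *~ u) = \prod_(w <- ws) h (s *~ w).
Proof.
move=> T0 n1 rel st hs cu cw e sz.
have inv : \prod_(w <- ws) h (s *~ - w) = (\prod_(w <- ws) h (s *~ w))^-1.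
  elim: ws cw {e sz} => [|w ws IH] /=; first by rewrite !big_nil invr1.
  by case/andP=> cw /IH {}IH; rewrite !big_cons IH (unit_opp T0 n1 rel st hs cw) invfM.
have nz : \prod_(w <- ws) h (s *~ w) != 0.
  rewrite prodf_seq_neq0; apply/allP => w /(allP cw) {}cw /=; exact: st.
apply: (divIf nz); rewrite divff // -inv.
have := rel ([seq s *~ u | u <- us] ++ [seq s *~ - w | w <- ws]).
rewrite size_cat !size_map !big_cat /= !big_map /= => -> //.
  rewrite all_cat !all_map; apply/andP; split; apply/allP => u.
    by move=> /(allP cu) {}cu /=; apply: st.
  by move=> /(allP cw) {}cw /=; apply: st; rewrite ?abszN.
rewrite !mulrz_sum_seq e (_ : \sum_(u <- ws) s *~ - u = s *~ - (\sum_(w <- ws) w)).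
  by rewrite -mulrzDr subrr mulr0z.
by under eq_bigr => w _ do rewrite mulrNz; rewrite sumrN mulrz_sum_seq mulrNz.
Qed.

Lemma power_witness_all (V : zmodType) (K : fieldType) (T : V -> Prop) (h : V -> K)
    (N n q : nat) (s : V) :
  T 0 -> (1 < n)%N -> relations_upto T h n -> unit_stable N h -> h s != 0 ->
  (forall k : nat, exists us, power_witness N h q s k us) ->
  forall k : int, exists us, power_witness N h q s k us.
Proof.
move=> T0 n1 rel st hs nonneg k; case: (intP k) => [|m|m]; try exact: nonneg.
have [us [cu sz su pu]] := nonneg m.+1.
exists [seq - u | u <- us]; split.
- by rewrite all_map; apply: sub_all cu => u /=; rewrite abszN.
- by rewrite size_map.
- by rewrite big_map sumrN su.
rewrite big_map -invr_expz -pu; elim: us cu {sz su pu} => [|u us IH] /=.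
  by rewrite !big_nil invr1.
by case/andP=> cu /IH {}IH; rewrite !big_cons IH (unit_opp T0 n1 rel st hs cu) invfM.
Qed.

(** Even exponents grow by 2: a pair of units is compared with a smaller pair together with 1 and 1,
    a relation of length 6. An odd exponent takes 1 as third unit. *)
Lemma power_witness3 (V : zmodType) (K : fieldType) (T : V -> Prop) (h : V -> K)
    (N n : nat) (s : V) :
  T 0 -> (0 < N)%N -> (6 <= n)%N -> relations_upto T h n -> unit_stable N h ->
  h s != 0 -> forall k : int, exists us, power_witness N h 3 s k us.
Proof.
move=> T0 N0 n6 rel st hs; have n1 : (1 < n)%N by lia.
apply: (power_witness_all T0 n1 rel st hs).
have ev (m : nat) (u v : int) : coprime `|u| N -> coprime `|v| N ->
    u + v = m.*2%:Z -> h (s *~ u) * h (s *~ v) = h s ^+ m.*2.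
  elim: m u v => [|m IH] u v cu cv uv.
    have := unit_relation (us := [:: u; v]) (ws := [::]) T0 n1 rel st hs.
    rewrite /= cu cv !big_cons !big_nil mulr1 addr0 expr0; apply=> //; lia.
  have [|u0 [v0 [cu0 cv0 e]]] := @unit_sum2 N m.*2%:Z N0; first by apply/orP; right; lia.
  have := unit_relation (us := [:: u; v]) (ws := [:: u0; v0; 1; 1]) T0 n1 rel st hs.
  rewrite /= cu cv cu0 cv0 !coprime1n !big_cons !big_nil !mulr1 !addr0 => ->; [|by []|by []|lia|lia].
  by rewrite mulrA IH // mulr1z doubleS !exprSr mulrA.
move=> k; have [|u0 [v0 [cu0 cv0 e]]] := @unit_sum2 N k./2.*2%:Z N0.
  by apply/orP; right; lia.
have p0 := ev _ _ _ cu0 cv0 e.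
case ok: (odd k).
  exists [:: u0; v0; 1]; split; rewrite //= ?cu0 ?cv0 ?coprime1n ?big_cons ?big_nil //.
    by rewrite -(odd_double_half k) ok; lia.
  by rewrite !mulr1 mulrA p0 mulr1z -exprSr -exprnP; congr (_ ^+ _); lia.
exists [:: u0; v0]; split; rewrite //= ?cu0 ?cv0 ?big_cons ?big_nil //.
  by rewrite -(odd_double_half k) ok; lia.
by rewrite !mulr1 p0 -exprnP; congr (_ ^+ _); lia.
Qed.

(** Comparing a pair for [x + t] with a pair for [x] and [t] would take length 5. Passing through
    [v] and [x - v] with [v + t] a unit splits this into relations of lengths at most 4 and 3. *)
Lemma power_witness2 (V : zmodType) (K : fieldType) (T : V -> Prop) (h : V -> K)
    (N n : nat) (s : V) :
  T 0 -> odd N -> (4 <= n)%N -> relations_upto T h n -> unit_stable N h ->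
  h s != 0 -> forall k : int, exists us, power_witness N h 2 s k us.
Proof.
move=> T0 oN n4 rel st hs; have n1 : (1 < n)%N by lia.
have step (x t : int) : (exists us, power_witness N h 2 s x us) ->
    coprime `|t| N -> h (s *~ t) = h s ^ t -> ~~ (3 %| x - t)%Z ->
    exists us, power_witness N h 2 s (x + t) us.
  move=> [us [cu sz su pu]] ct ht xt.
  have [v [cv cxv cvt]] := unit_sum2_shift oN ct xt.
  exists [:: v + t; x - v]; split; rewrite /= ?cvt ?cxv //.
    by rewrite !big_cons big_nil; ring.
  have := unit_relation (us := us) (ws := [:: v; x - v]) T0 n1 rel st hs cu.
  rewrite /= cv cxv su !big_cons !big_nil mulr1 addr0 => /(_ isT) e4.
  have := unit_relation (us := [:: v + t]) (ws := [:: v; t]) T0 n1 rel st hs.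
  rewrite /= cvt cv ct !big_cons !big_nil !mulr1 !addr0 => -> //; last by lia.
  rewrite expfzDr // -pu e4; [by rewrite ht mulrAC | by ring | by lia].
have c1 : coprime `|1%:Z| N by exact: coprime1n.
have c2 : coprime `|2%:Z| N by rewrite coprime2n.
have h1 : h (s *~ 1) = h s ^ 1 by rewrite mulr1z expr1z.
have hm1 : h (s *~ - 1) = h s ^ (- 1) by rewrite (unit_opp T0 n1 rel st hs c1) mulr1z exprN1.
have h2 : h (s *~ 2) = h s ^ 2.
  have := unit_relation (us := [:: 2]) (ws := [:: 1; 1]) T0 n1 rel st hs.
  rewrite /= c2 c1 !big_cons !big_nil !mulr1 !addr0 => -> //; last by lia.
apply: (power_witness_all T0 n1 rel st hs); elim=> [|k IH].
  by exists [::]; split; rewrite ?big_nil ?expr0z.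
have -> : k.+1%:Z = k%:Z + 1 by lia.
case: (boolP (3 %| k%:Z - 1)%Z) => k1; last exact: step.
(* The step +1 is obstructed when k = 1 mod 3; the steps -1 and +2 are not. *)
have -> : k%:Z + 1 = k%:Z - 1 + 2 by lia.
apply: (step) => //; last by lia.
by apply: step => //; lia.
Qed.

(** Each term is expanded into at most [q] unit multiples, which [unit_stable] keeps in the
    support. *)
Lemma weighted_relation (V : zmodType) (K : fieldType) (T : V -> Prop) (h : V -> K)
    (N q m : nat) (sk : seq (V * int)) :
  relations_upto T h (q * m) -> unit_stable N h ->
  (forall s, h s != 0 -> forall k, exists us, power_witness N h q s k us) ->
  (size sk <= m)%N -> all (fun x => h x.1 != 0) sk ->
  T (\sum_(x <- sk) x.1 *~ x.2) -> \prod_(x <- sk) h x.1 ^ x.2 = 1.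
Proof.
move=> rel st wit sz hsk Tsk.
have [ws [hw szw sw pw]] : exists ws, [/\ all (fun s => h s != 0) ws,
    (size ws <= q * size sk)%N, \sum_(w <- ws) w = \sum_(x <- sk) x.1 *~ x.2
    & \prod_(w <- ws) h w = \prod_(x <- sk) h x.1 ^ x.2].
  elim: sk hsk {sz Tsk} => [|[s k] sk IH] /=; first by exists [::]; rewrite !big_nil.
  case/andP=> hs /IH[ws [hw szw sw pw]]; have [us [cu szu su pu]] := wit s hs k.
  exists ([seq s *~ u | u <- us] ++ ws); split.
  - rewrite all_cat hw andbT all_map; apply/allP => u /(allP cu) {}cu /=; exact: st.
  - by rewrite size_cat size_map mulnS leq_add.
  - by rewrite big_cat big_cons big_map /= mulrz_sum_seq su sw.
  - by rewrite big_cat big_cons big_map /= pu pw.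
rewrite -pw rel ?sw //; apply: leq_trans szw _.
by rewrite leq_mul2l sz orbT.
Qed.

(** * Relations of every length *)

(** The prime 2 already shows that [z] is a root of unity. A prime factor of its order would divide
    every exponent killing [z], against the hypothesis at that prime. *)
Lemma eq1_of_coprime_powers (K : fieldType) (z : K) :
  (forall p : nat, prime p -> exists2 m : int, ~~ (p %| m)%Z & z ^ m = 1) -> z = 1.
Proof.
move=> H.
have H' p : prime p -> exists2 m : nat, ~~ (p %| m)%N & z ^+ m = 1.
  move=> /H[m pm zm]; exists `|m|%N; first by rewrite dvdzE in pm.
  by case: m {pm} zm => m //= /eqP; rewrite invr_eq1 => /eqP.
have [m m2 zm] := H' 2%N isT.
have m0 : (0 < m)%N by case: m m2 {zm}.
have [o oz om] := prim_order_exists m0 zm.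
case: (ltnP 1 o) => o1; last first.
  by have := prim_order_gt0 oz; case: o o1 oz {om} => [|[|o]] // _ /prim_expr_order.
have [k kp zk] := H' _ (pdiv_prime o1).
have ok : (o %| k)%N by rewrite (prim_order_dvd oz) zk.
by rewrite (dvdn_trans (pdiv_dvd _) ok) in kp.
Qed.

(* Locally at each prime, r of the members span all the others, so that a
   relation of arbitrary length splits into relations with at most r + 1
   distinct members. *)
Lemma relations_all (K : fieldType) (r N q : nat) (T : 'rV[int]_r -> Prop)
    (h : 'rV[int]_r -> K) (n : nat) :
  T 0 -> (forall v k, T v -> T (v *~ k)) ->
  relations_upto T h (q * r.+1) -> unit_stable N h ->
  (forall s, h s != 0 -> forall k, exists us, power_witness N h q s k us) ->
  relations_upto T h n.
Proof.
move=> T0 TZ rel st wit [|s0 ss'] _ hss Tss; first by rewrite big_nil.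
set ss := s0 :: ss' in hss Tss *.
apply: eq1_of_coprime_powers => p pp.
pose s (i : 'I_(size ss)) := nth 0 ss i.
have hs i : h (s i) != 0 by apply: (allP hss); apply: mem_nth.
have [b [m [pm H]]] := @local_basis _ (ord0 : 'I_(size ss)) p r r s pp.
exists m => //.
have {}H i : exists c : 'I_r -> int, s i *~ m = \sum_j s (b j) *~ c j.
  have [c cE] := H i; exists c; apply/eqP; rewrite -subr_eq0; apply/eqP/rowP => l.
  by rewrite cE // mxE.
have [c cE] : exists c : 'I_(size ss) -> 'I_r -> int,
    forall i, s i *~ m = \sum_j s (b j) *~ c i j.
  by apply: (@fin_all_exists _ (fun _ => 'I_r -> int)
    (fun i c => s i *~ m = \sum_j s (b j) *~ c j)).
(* This is a relation among [s i] and the [r] basis members, whence the bound [r.+1]. *)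
have hE i : h (s i) ^ m = \prod_j h (s (b j)) ^ c i j.
  have := @weighted_relation _ _ T h N q r.+1
    ((s i, m) :: [seq (s (b j), - c i j) | j <- enum 'I_r]) rel st wit.
  rewrite /= size_map size_enum_ord leqnn hs all_map !big_cons !big_map -!enumT !big_enum /= cE.
  under eq_bigr => j _ do rewrite mulrNz.
  rewrite sumrN subrr; under eq_bigr => j _ do rewrite -invr_expz.
  rewrite prodfV => e; apply: (divIf (y := \prod_j h (s (b j)) ^ c i j)).
    by apply/prodf_neq0 => j _; rewrite expfz_neq0.
  rewrite divff; first by apply: e => //; apply/allP => j _ /=.
  by apply/prodf_neq0 => j _; rewrite expfz_neq0.
(* Multiplied by [m], the whole relation becomes one among the basis members alone. *)
have sE : \sum_(s <- ss) s *~ m = \sum_j s (b j) *~ (\sum_i c i j).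
  rewrite (big_nth 0) big_mkord; under eq_bigr => i _ do rewrite -/(s i) cE.
  by rewrite exchange_big; apply: eq_bigr => j _; rewrite mulrz_sumr.
have -> : (\prod_(s <- ss) h s) ^ m = \prod_j h (s (b j)) ^ (\sum_i c i j).
  have pz (I : Type) (l : seq I) (F : I -> K) : (\prod_(i <- l) F i) ^ m = \prod_(i <- l) F i ^ m.
    elim: l => [|i l IH]; first by rewrite !big_nil exp1rz.
    by rewrite !big_cons expfzMl IH.
  rewrite pz (big_nth 0) big_mkord (eq_bigr _ (fun i _ => hE i)).
  rewrite exchange_big; apply: eq_bigr => j _.
  elim/big_rec2: _ => [|i x y _ ->]; first by rewrite expr0z.
  by rewrite expfzDr.
have := @weighted_relation _ _ T h N q r.+1
  [seq (s (b j), \sum_i c i j) | j <- enum 'I_r] rel st wit.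
rewrite size_map size_enum_ord leqnSn all_map !big_map -!enumT !big_enum /= => -> //.
  by apply/allP => j _ /=.
by rewrite -sE -mulrz_suml; apply: TZ.
Qed.

(** * Fourier analysis on the grid *)

Definition grid_char (r : nat) (a : 'I_r -> nat) (z : 'I_r -> algC)
    (k : 'rV[int]_r) (x : grid a) : algC :=
  \prod_j z j ^ (k 0 j * (x j)%:Z).

Definition grid_index (r : nat) (a : 'I_r -> nat) (k : grid a) : 'rV[int]_r :=
  \row_j (k j)%:Z.

Definition fourier (r : nat) (a : 'I_r -> nat) (z : 'I_r -> algC)
    (f : grid a -> rat) (k : 'rV[int]_r) : algC :=
  \sum_x ratr (f x) * grid_char z k x.

(* Interpolates between the autocorrelation (ks = [::]) and the product of
   Fourier coefficients (xs = [::]), transforming one variable at a time. *)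
Definition mixed_corr (r : nat) (a : 'I_r -> nat) (z : 'I_r -> algC)
    (f : grid a -> rat) (xs : seq (grid a)) (ks : seq 'rV[int]_r) : algC :=
  \sum_y ratr (f y) * \prod_(x <- xs) ratr (f (grid_add y x))
    * \prod_(k <- ks) (fourier z f k * grid_char z (- k) y).

Lemma grid_addE (r : nat) (a : 'I_r -> nat) (x y : grid a) j :
  grid_add x y j = ord_addmod (x j) (y j).
Proof. by rewrite /grid_add ffunE. Qed.

Lemma grid_addC (r : nat) (a : 'I_r -> nat) (x y : grid a) : grid_add x y = grid_add y x.
Proof. by apply/ffunP => j; rewrite !grid_addE; apply: val_inj; rewrite /= addnC. Qed.

Lemma grid_addA (r : nat) (a : 'I_r -> nat) (x y w : grid a) :
  grid_add x (grid_add y w) = grid_add (grid_add x y) w.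
Proof.
apply/ffunP => j; rewrite !grid_addE; apply: val_inj.
by rewrite /= modnDmr modnDml addnA.
Qed.

Lemma grid_add_inj (r : nat) (a : 'I_r -> nat) (y : grid a) : injective (grid_add y).
Proof.
move=> x w /ffunP e; apply/ffunP => j; have := congr1 val (e j).
rewrite !grid_addE /= => /eqP; rewrite eqn_modDl !modn_small ?ltn_ord // => /eqP.
exact: val_inj.
Qed.

Lemma grid_sum_shift (r : nat) (a : 'I_r -> nat) (M : nmodType) (y : grid a)
    (F : grid a -> M) : \sum_x F (grid_add y x) = \sum_x F x.
Proof.
rewrite [RHS](reindex (grid_add y)) //.
exact/onW_bij/injF_bij/grid_add_inj.
Qed.

Lemma card_grid (r : nat) (a : 'I_r -> nat) : #|grid a| = (\prod_j a j)%N.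
Proof.
rewrite card_dep_ffun foldrE big_map big_enum /=.
by apply: eq_bigr => j _; rewrite card_ord.
Qed.

Lemma card_grid_gt0 (r : nat) (a : 'I_r -> nat) :
  (forall j, 0 < a j)%N -> (0 < #|grid a|)%N.
Proof. by move=> a0; rewrite card_grid prodn_gt0. Qed.

Lemma prim_root_neq0 (K : fieldType) (n : nat) (z : K) : n.-primitive_root z -> z != 0.
Proof.
move=> pz; apply: contra_eqN (prim_expr_order pz) => /eqP ->.
by rewrite expr0n gtn_eqF ?(prim_order_gt0 pz) // eq_sym oner_neq0.
Qed.

Section GridCharacters.

Context (r : nat) (a : 'I_r -> nat) (z : 'I_r -> algC).
Hypothesis pz : forall j, (a j).-primitive_root (z j).

Local Notation E := (@grid_char r a z).
Local Notation F := (fourier z).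

Let z_neq0 j : z j != 0 := prim_root_neq0 (pz j).

Lemma grid_charD k l x : E (k + l) x = E k x * E l x.
Proof. by rewrite /grid_char -big_split; apply: eq_bigr => j _; rewrite mxE mulrDl expfzDr. Qed.

Lemma grid_char0 x : E 0 x = 1.
Proof. by rewrite /grid_char big1 // => j _; rewrite mxE mul0r expr0z. Qed.

Lemma grid_char_neq0 k x : E k x != 0.
Proof. by apply/prodf_neq0 => j _; rewrite expfz_neq0. Qed.

Lemma grid_charMz k t x : E (k *~ t) x = E k x ^ t.
Proof.
rewrite -scaler_int /grid_char; elim/big_rec2: _ => [|j u v _ IH]; first by rewrite exp1rz.
by rewrite IH expfzMl exprz_exp !mxE intz; congr (_ ^ _ * _); ring.
Qed.

Lemma grid_charN k x : E (- k) x = (E k x)^-1.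
Proof. by rewrite -[k in LHS]mulr1z -mulrNz grid_charMz exprN1. Qed.

Lemma grid_char_sum (ks : seq 'rV[int]_r) x :
  E (\sum_(k <- ks) k) x = \prod_(k <- ks) E k x.
Proof.
elim: ks => [|k ks IH]; first by rewrite !big_nil grid_char0.
by rewrite !big_cons grid_charD IH.
Qed.

Lemma exprz_mod_order j (m : nat) (k : int) : z j ^ (k * (m %% a j)%N%:Z) = z j ^ (k * m%:Z).
Proof.
rewrite {2}(divn_eq m (a j)) PoszD mulrDr expfzDr // PoszM mulrA [k * _ * _]mulrC.
by rewrite -(exprz_exp _ (a j)) -(exprnP _ (a j)) (prim_expr_order (pz j)) exp1rz mul1r.
Qed.

Lemma grid_char_add k x y : E k (grid_add x y) = E k x * E k y.
Proof.
rewrite /grid_char -big_split; apply: eq_bigr => j _; rewrite grid_addE /= exprz_mod_order.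
by rewrite PoszD mulrDr expfzDr.
Qed.

Lemma grid_char_index_sym (k x : grid a) : E (grid_index k) x = E (grid_index x) k.
Proof. by apply: eq_bigr => j _; rewrite !mxE mulrC. Qed.

Lemma grid_char_exp_card k x : E k x ^+ #|grid a| = 1.
Proof.
rewrite exprnP -grid_charMz /grid_char big1 // => j _.
rewrite -scaler_int !mxE intz card_grid (bigD1 j) //= PoszM -!mulrA -(exprz_exp _ (a j)).
by rewrite -(exprnP _ (a j)) (prim_expr_order (pz j)) exp1rz.
Qed.

Lemma fourier_shift (f : grid a -> rat) k y :
  \sum_x E k x * ratr (f (grid_add y x)) = F f k * E (- k) y.
Proof.
rewrite /fourier -[in RHS](grid_sum_shift y) mulr_suml; apply: eq_bigr => x _.
by rewrite grid_char_add grid_charN; field; apply: grid_char_neq0.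
Qed.

Lemma mixed_corr_cons (f : grid a -> rat) xs k ks :
  mixed_corr z f xs (k :: ks) = \sum_x E k x * mixed_corr z f (x :: xs) ks.
Proof.
rewrite /mixed_corr; under [RHS]eq_bigr => x _ do rewrite mulr_sumr.
rewrite exchange_big; apply: eq_bigr => y _ /=.
rewrite big_cons -fourier_shift mulr_suml mulr_sumr; apply: eq_bigr => x _.
by rewrite big_cons; ring.
Qed.

Lemma mixed_corr_nil (f : grid a -> rat) ks :
  mixed_corr z f [::] ks = F f (- (\sum_(k <- ks) k)) * \prod_(k <- ks) F f k.
Proof.
rewrite /mixed_corr mulr_suml; apply: eq_bigr => y _.
rewrite big_nil mulr1 big_split /= grid_charN grid_char_sum -prodfV mulrA mulrAC.
by congr (_ * _ * _); apply: eq_bigr => k _; rewrite grid_charN.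
Qed.

Lemma mixed_corr_autocorr (f : grid a -> rat) xs : mixed_corr z f xs [::] = ratr (autocorr f xs).
Proof.
rewrite rmorph_sum; apply: eq_bigr => y _.
by rewrite big_nil mulr1 rmorphM rmorph_prod.
Qed.

(** Up to a trivial character, one frequency of a relation is minus the sum of the others, so [n]
    coefficients come from only [n - 1] shifts. *)
Lemma fourier_products (n : nat) (f g : grid a -> rat) :
  (forall xs, (size xs < n)%N -> autocorr g xs = autocorr f xs) ->
  forall ks : seq 'rV[int]_r, (size ks <= n)%N ->
    (forall x, E (\sum_(k <- ks) k) x = 1) ->
    \prod_(k <- ks) F g k = \prod_(k <- ks) F f k.
Proof.
move=> H [|k ks]; first by rewrite !big_nil.
move=> /= szk Tk.
have mix xs ls : (size xs + size ls < n)%N -> mixed_corr z g xs ls = mixed_corr z f xs ls.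
  elim: ls xs => [|l ls IH] xs; first by rewrite addn0 !mixed_corr_autocorr => /H ->.
  move=> sz; rewrite !mixed_corr_cons; apply: eq_bigr => x _.
  by rewrite IH //= addSnnS.
have kE (f' : grid a -> rat) : F f' k = F f' (- (\sum_(l <- ks) l)).
  apply: eq_bigr => x _; congr (_ * _).
  by rewrite -[RHS]mul1r -(Tk x) -grid_charD big_cons addrK.
by rewrite !big_cons !kE -!mixed_corr_nil mix.
Qed.

(** For distinct points some [l] gives a ratio other than 1; translating by [l] multiplies the sum
    by that ratio without changing it. *)
Lemma grid_char_orthogonality (x w : grid a) :
  \sum_(k : grid a) E (grid_index k) x / E (grid_index k) w = (x == w)%:R * #|grid a|%:R.
Proof.
have phiD (k l : grid a) : E (grid_index (grid_add k l)) x / E (grid_index (grid_add k l)) w =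
    (E (grid_index k) x / E (grid_index k) w) * (E (grid_index l) x / E (grid_index l) w).
  rewrite !(grid_char_index_sym (grid_add k l)) !grid_char_add invfM.
  by rewrite !(grid_char_index_sym _ k) !(grid_char_index_sym _ l); ring.
have [->|xw] := eqVneq x w.
  under eq_bigr => k _ do rewrite divff ?grid_char_neq0 //.
  by rewrite sumr_const mul1r.
rewrite mul0r.
have [l l1] : exists l : grid a, E (grid_index l) x / E (grid_index l) w != 1.
  apply/existsP; apply: contraNT xw => /existsPn H; apply/eqP/ffunP => j.
  (* The [j]-th unit vector; the reduction modulo [a i] covers coordinates of modulus 1, where the
     residue 1 is 0. *)
  pose l : grid a := [ffun i => Ordinal (ltn_pmod (i == j) (ord_pos (x i)))].
  have El y : E (grid_index l) y = z j ^+ y j.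
    rewrite /grid_char (bigD1 j) //= [X in _ * X]big1 => [|i ij].
      by rewrite mulr1 mxE ffunE /= eqxx mulrC exprz_mod_order mulr1.
    by rewrite mxE ffunE /= (negPf ij) mod0n mul0r expr0z.
  have := H l; rewrite negbK !El => /eqP /(canRL (divfK _)).
  rewrite mul1r expf_neq0 // => /(_ isT)/eqP.
  by rewrite (eq_prim_root_expr (pz j)) !modn_small // => /eqP/val_inj.
move: l1; rewrite -subr_eq0 => /mulfI; apply.
rewrite mulr0 mulrBl mul1r mulr_sumr -[X in _ - X](grid_sum_shift l).
by apply/eqP; rewrite subr_eq0; apply/eqP; apply: eq_bigr => k _; rewrite phiD.
Qed.

Lemma fourier_inversion (f : grid a -> rat) (w : grid a) : (forall j, 0 < a j)%N ->
  ratr (f w) = \sum_(k : grid a) #|grid a|%:R^-1 * E (- grid_index k) w * F f (grid_index k).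
Proof.
move=> a0; have c0 : #|grid a|%:R != 0 :> algC by rewrite pnatr_eq0 -lt0n card_grid_gt0.
under eq_bigr => k _ do rewrite mulr_sumr.
rewrite exchange_big /= (bigD1 w) //= [X in _ + X]big1 ?addr0.
  under eq_bigr => k _ do
    rewrite grid_charN mulrC -mulrA [E _ w * _]mulrCA divff ?grid_char_neq0 // mulr1.
  by rewrite -mulr_sumr sumr_const -[X in _ * X]mulr_natr mulVf // mulr1.
move=> x xw.
rewrite (eq_bigr (fun k : grid a => (#|grid a|%:R^-1 * ratr (f x)) *
    (E (grid_index k) x / E (grid_index k) w))); last first.
  by move=> k _; rewrite grid_charN; ring.
by rewrite -mulr_sumr grid_char_orthogonality (negPf xw) mul0r mulr0.
Qed.

Lemma mixed_corr_invert (f : grid a -> rat) x xs ks : (forall j, 0 < a j)%N ->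
  mixed_corr z f (x :: xs) ks = \sum_(k : grid a) #|grid a|%:R^-1 * E (- grid_index k) x
    * mixed_corr z f xs (grid_index k :: ks).
Proof.
move=> a0; transitivity (\sum_y \sum_(k : grid a) #|grid a|%:R^-1 * E (- grid_index k) x
    * (ratr (f y) * \prod_(x0 <- xs) ratr (f (grid_add y x0))
    * \prod_(l <- grid_index k :: ks) (F f l * E (- l) y))); last first.
  by rewrite exchange_big; apply: eq_bigr => k _ /=; rewrite -mulr_sumr.
apply: eq_bigr => y _; rewrite big_cons (fourier_inversion f (grid_add y x)) //.
rewrite mulr_suml mulr_sumr mulr_suml.
by apply: eq_bigr => k _; rewrite grid_char_add big_cons; ring.
Qed.

Lemma autocorr_of_fourier_products (f g : grid a -> rat) : (forall j, 0 < a j)%N ->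
  (forall ks : seq 'rV[int]_r, (forall x, E (\sum_(k <- ks) k) x = 1) ->
    \prod_(k <- ks) F g k = \prod_(k <- ks) F f k) ->
  forall xs, autocorr g xs = autocorr f xs.
Proof.
move=> a0 H xs; apply: (fmorph_inj (ratr : {rmorphism rat -> algC})).
(* Each shift is traded for a frequency by Fourier inversion, so the list of frequencies must be
   general. *)
rewrite /= -!mixed_corr_autocorr; elim: xs [::] => [|x xs IH] ks; last first.
  by rewrite !mixed_corr_invert //; apply: eq_bigr => k _; rewrite IH.
rewrite !mixed_corr_nil; have := H (- (\sum_(k <- ks) k) :: ks).
by rewrite !big_cons; apply=> x; rewrite addNr grid_char0.
Qed.

(** The automorphism raising roots of unity of order dividing [#|grid a|] to the power [t] fixes the
    rational values of [f], so it carries one coefficient to the other. *)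
Lemma fourier_unit_stable (f : grid a -> rat) k t :
  coprime `|t| #|grid a| -> (forall j, 0 < a j)%N ->
  F f k != 0 -> F f (k *~ t) != 0.
Proof.
move=> ct a0; have N0 := card_grid_gt0 a0.
pose t' := `|(t %% #|grid a|)%Z|%N.
have t'E : t'%:Z = (t %% #|grid a|)%Z by rewrite gez0_abs // modz_ge0 // -lt0n.
have ct' : coprime t' #|grid a|.
  move: ct; rewrite -[coprime _ _]/(coprimez t #|grid a|) -[coprime _ _]/(coprimez t' #|grid a|).
  by rewrite t'E /coprimez gcdz_modl.
have [u uE] := Qn_aut_exists ct'.
have -> : F f (k *~ t) = u (F f k); last by rewrite fmorph_eq0.
rewrite rmorph_sum; apply: eq_bigr => x _.
rewrite rmorphM /= fmorph_rat uE ?grid_char_exp_card // grid_charMz; congr (_ * _).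
rewrite {1}(divz_eq t #|grid a|) -t'E expfzDr ?grid_char_neq0 //.
rewrite [_ * #|grid a|%:Z]mulrC -(exprz_exp _ #|grid a|).
by rewrite -(exprnP _ #|grid a|) grid_char_exp_card exp1rz mul1r.
Qed.

End GridCharacters.

(** * From all autocorrelations to a translation *)

Lemma translate_of_autocorr (r : nat) (a : 'I_r -> nat) (f g : grid a -> rat) :
  (forall j, 0 < a j)%N -> (forall xs, autocorr g xs = autocorr f xs) ->
  exists y, forall x, g x = f (grid_add x y).
Proof.
move=> a0 H.
pose Inv (P : (grid a -> rat) -> rat) := forall xs,
  \sum_y g y * \prod_(x <- xs) g (grid_add y x) * P (fun x => g (grid_add y x))
  = \sum_y f y * \prod_(x <- xs) f (grid_add y x) * P (fun x => f (grid_add y x)).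
(* Quantifying over [P] makes [good] closed under sums and products, so polynomials in the values of
   [u] need no syntax. *)
pose good Q := forall P, Inv P -> Inv (fun u => P u * Q u).
have goodC c : good (fun _ => c).
  by move=> P HP xs; under eq_bigr do rewrite mulrA;
     under [RHS]eq_bigr do rewrite mulrA; rewrite -!mulr_suml HP.
have goodX x : good (fun u => u x).
  move=> P HP xs; have := HP (x :: xs).
  under eq_bigr do rewrite big_cons; under [X in _ = X -> _]eq_bigr do rewrite big_cons.
  move=> e; transitivity (\sum_y g y * (g (grid_add y x) * \prod_(x <- xs) g (grid_add y x))
     * P (fun x => g (grid_add y x))); first by apply: eq_bigr => y _; ring.
  by rewrite e; apply: eq_bigr => y _; ring.
have goodD P Q : good P -> good Q -> good (fun u => P u + Q u).
  move=> HP HQ R HR xs; have := HP R HR xs; have := HQ R HR xs => eQ eP.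
  under eq_bigr do rewrite mulrDr mulrDr; under [RHS]eq_bigr do rewrite mulrDr mulrDr.
  by rewrite !big_split /= eP eQ.
have goodM P Q : good P -> good Q -> good (fun u => P u * Q u).
  move=> HP HQ R HR xs; have := HQ _ (HP _ HR) xs.
  under eq_bigr do rewrite -[_ * P _ * Q _]mulrA.
  by under [X in _ = X -> _]eq_bigr do rewrite -[_ * P _ * Q _]mulrA.
pose D w (u : grid a -> rat) := \sum_x (u x - f (grid_add x w)) ^+ 2.
have goodDw w : good (D w).
  have gd x : good (fun u => (u x - f (grid_add x w)) ^+ 2).
    have := goodD _ _ (goodX x) (goodC (- f (grid_add x w))) => gx.
    exact: (goodM _ _ gx gx).
  rewrite /D; elim: (index_enum (grid a)) => [|x l IH] P HP xs.
    by under eq_bigr do rewrite big_nil; under [RHS]eq_bigr do rewrite big_nil;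
       exact: (goodC 0 P HP xs).
  under eq_bigr do rewrite big_cons; under [RHS]eq_bigr do rewrite big_cons.
  exact: (goodD _ _ (gd x) IH P HP xs).
have good_prod : good (fun u => \prod_w D w u).
  elim: (index_enum (grid a)) => [|w l IH] P HP xs.
    by under eq_bigr do rewrite big_nil; under [RHS]eq_bigr do rewrite big_nil;
       exact: (goodC 1 P HP xs).
  under eq_bigr do rewrite big_cons; under [RHS]eq_bigr do rewrite big_cons.
  exact: (goodM _ _ (goodDw w) IH P HP xs).
have Inv1 : Inv (fun _ => 1).
  move=> xs; have := H xs; rewrite /autocorr => e.
  by under eq_bigr do rewrite mulr1; under [RHS]eq_bigr do rewrite mulr1.
pose o : grid a := [ffun j => Ordinal (a0 j)].
have addo x : grid_add x o = x.
  by apply/ffunP => j; rewrite grid_addE ffunE; apply: val_inj; rewrite /= addn0 modn_small.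
have D0 w u : D w u = 0 -> forall x, u x = f (grid_add x w).
  move=> /eqP; rewrite psumr_eq0 => [|x _]; last exact: sqr_ge0.
  by move=> /allP e x; have := e x (mem_index_enum x); rewrite sqrf_eq0 subr_eq0 => /eqP.
have Dge0 w u : 0 <= D w u by apply: sumr_ge0 => x _; exact: sqr_ge0.
have sq u y : u y * \prod_(x <- [:: o]) u (grid_add y x) = u y ^+ 2.
  by rewrite big_cons big_nil mulr1 addo expr2.
have Df y : \prod_w D w (fun x => f (grid_add y x)) = 0.
  apply/eqP/prodf_eq0; exists y => //=.
  by rewrite /D big1 // => x _; rewrite grid_addC subrr expr0n.
(* The zero shift [o] turns the weight into [g y ^+ 2], so a vanishing sum has only zero terms. *)
have := good_prod _ Inv1 [:: o].
rewrite [RHS]big1 => [/eqP|y _]; last by rewrite Df !mulr0.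
rewrite psumr_eq0 => [/allP zero|y _]; last first.
  by rewrite sq mul1r mulr_ge0 ?sqr_ge0 ?prodr_ge0.
(* If [g] vanishes, then so does the sum of the squares of [f], and any translation will do. *)
case: (pickP (fun y => g y != 0)) => [y gy|g0]; last first.
  exists o => x; rewrite addo; have /eqP -> := negbFE (g0 x).
  have := H [:: o]; rewrite /autocorr big1 => [/esym/eqP|y _].
    rewrite psumr_eq0 => [/allP/(_ x (mem_index_enum x))|y _]; last by rewrite sq sqr_ge0.
    by rewrite sq sqrf_eq0 => /eqP.
  by have /eqP -> := negbFE (g0 y); rewrite mul0r.
have := zero y (mem_index_enum y); rewrite sq mul1r mulf_eq0 sqrf_eq0 (negPf gy) /=.
rewrite prodf_seq_eq0 => /hasP[w _ /eqP/D0 e].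
have [h hK hK'] := injF_bij (@grid_add_inj r a y).
(* Here [g] translated by [y] is [f] translated by [w]; [h w] is [w - y]. *)
exists (h w) => x; rewrite -[in LHS](hK' x) e -[in RHS](hK' x) -[in LHS](hK' w).
by rewrite grid_addA [grid_add _ y]grid_addC.
Qed.

(** * From bounded order to all orders *)

Lemma translate_of_bounded_autocorr (r : nat) (a : 'I_r -> nat) (q : nat)
    (f g : grid a -> rat) : (forall j, 0 < a j)%N ->
  (forall (T : 'rV[int]_r -> Prop) h, T 0 -> relations_upto T h (q * r.+1) ->
    unit_stable #|grid a| h -> forall s : 'rV[int]_r, h s != 0 :> algC ->
    forall k, exists us, power_witness #|grid a| h q s k us) ->
  (2 <= q * r.+1)%N ->
  (forall xs, (size xs < q * r.+1)%N -> autocorr g xs = autocorr f xs) ->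
  exists y, forall x, g x = f (grid_add x y).
Proof.
move=> a0 wit q2 H; apply: translate_of_autocorr => //.
pose z j := sval (C_prim_root_exists (a0 j)).
have pz j : (a j).-primitive_root (z j).
  exact: (svalP (C_prim_root_exists (a0 j))).
pose T (v : 'rV[int]_r) := forall x : grid a, grid_char z v x = 1.
have T0 : T 0 by move=> x; apply: grid_char0.
have TZ v k : T v -> T (v *~ k) by move=> Tv x; rewrite grid_charMz // Tv exp1rz.
have prods := fourier_products pz H.
have N0 := card_grid_gt0 a0.
(* Order 2 gives the product of the coefficients at [k] and [- k], which vanish together because -1
   is a unit. *)
have zeros k : (fourier z g k == 0) = (fourier z f k == 0).
  have opp (f' : grid a -> rat) :
      (fourier z f' k * fourier z f' (- k) == 0) = (fourier z f' k == 0).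
    rewrite mulf_eq0; case: eqVneq => //= fk; apply: negbTE.
    by rewrite -[k]mulr1z -mulrNz (fourier_unit_stable pz) // coprime1n.
  have := prods [:: k; - k] q2; rewrite !big_cons !big_nil !mulr1 addr0 subrr => e.
  by rewrite -opp -[RHS]opp e // => x; apply: grid_char0.
(* Division by zero yields 0, so [h] is nonzero exactly on the common support. *)
pose h k := fourier z g k / fourier z f k.
have hE k : (h k != 0) = (fourier z f k != 0).
  by rewrite mulf_eq0 invr_eq0 zeros orbb.
have prod_h ks : \prod_(k <- ks) h k =
    \prod_(k <- ks) fourier z g k / \prod_(k <- ks) fourier z f k.
  by rewrite big_split /= prodfV.
have nz ks : all (fun k => h k != 0) ks -> \prod_(k <- ks) fourier z f k != 0.
  by move=> hks; rewrite prodf_seq_neq0; apply: sub_all hks => k; rewrite hE.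
have rel : relations_upto T h (q * r.+1).
  by move=> ks sz hks Tks; rewrite prod_h prods // divff ?nz.
have st : unit_stable #|grid a| h.
  by move=> s t ct; rewrite !hE; exact: (fourier_unit_stable pz ct a0).
have all_rel n : relations_upto T h n.
  exact: (relations_all T0 TZ rel st (wit T h T0 rel st)).
apply: (autocorr_of_fourier_products pz a0) => ks Tks.
case: (boolP (all (fun k => h k != 0) ks)) => [hks|/allPn[k kks]].
  have := all_rel (size ks) ks (leqnn _) hks Tks.
  by rewrite prod_h => /(canRL (divfK (nz _ hks))); rewrite mul1r.
(* A relation leaving the support has a zero factor on both sides. *)
rewrite hE negbK => fk; transitivity (0 : algC); [|symmetry]; apply/eqP;
  rewrite prodf_seq_eq0; apply/hasP; exists k; rewrite ?zeros //.
Qed.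

Unset Implicit Arguments.

Theorem mainTheorem1 (r : nat) (a : 'I_r -> nat) :
  (1 <= r)%N -> (forall k, (0 < a k)%N) ->
  forall f : grid a -> rat,
    (odd #|grid a| ->
      forall g : grid a -> rat,
        (forall (n : nat) (xs : seq (grid a)),
            (1 <= n <= 2 * r + 2)%N -> size xs = n.-1 ->
            autocorr g xs = autocorr f xs) ->
        exists y : grid a, forall x : grid a, g x = f (grid_add x y))
    /\
    (~~ odd #|grid a| ->
      forall g : grid a -> rat,
        (forall (n : nat) (xs : seq (grid a)),
            (1 <= n <= 3 * r + 3)%N -> size xs = n.-1 ->
            autocorr g xs = autocorr f xs) ->
        exists y : grid a, forall x : grid a, g x = f (grid_add x y)).
Proof.
move=> r1 a0 f; split=> [oddG | _] g H.
  apply: (@translate_of_bounded_autocorr r a 2) => //; [|lia|].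
    move=> T h T0 rel st s hs; apply: (power_witness2 T0 oddG _ rel st hs); lia.
  by move=> xs sz; apply: (H (size xs).+1) => //; lia.
apply: (@translate_of_bounded_autocorr r a 3) => //; [|lia|].
  move=> T h T0 rel st s hs.
  apply: (power_witness3 T0 (card_grid_gt0 a0) _ rel st hs); lia.
by move=> xs sz; apply: (H (size xs).+1) => //; lia.
Qed.
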